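(* Let $k\ge 2$ be an integer. Every simple graph $G$ with $n$ vertices and $m$ edges has a balanced partition of $V(G)$ into $k$ sets $V_1,\ldots,V_k$ such that $$\max_{1\le i<j\le k}e_G(V_i\cup V_j)\le \frac{4m}{k^2}+\frac{3(k-2)}{k^2}\sqrt{2m+\frac14}+\frac{(k-2)(2k-5)}{10}+C_k n,$$ where $$C_k=\frac{k-2}{k^2}+\frac{k-2}{k(k-1)}\sqrt{k(k-1)-2}.$$
   Context: All graphs are finite and simple. For $S\subseteq V(G)$, $e_G(S)$ is the number of edges of $G$ with both endpoints in $S$. A partition $V(G)=V_1\cup\cdots\cup V_k$ into pairwise disjoint sets (parts may be empty) is called balanced if $\bigl||V_i|-|V_j|\bigr|\le 1$ for all $i,j\in[k]=\{1,\ldots,k\}$. *)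

(* Defs.v *)
From mathcomp Require Import all_boot all_order all_algebra.

Set Implicit Arguments.
Unset Strict Implicit.
Unset Printing Implicit Defensive.

Import Order.TTheory GRing.Theory Num.Theory.

(* A finite simple graph is a symmetric irreflexive relation [e] on a finType;
   edges are unordered, i.e. two-element sets of adjacent vertices. *)
Definition simple_graph (T : finType) (e : rel T) : Prop :=
  symmetric e /\ irreflexive e.

Definition edges (T : finType) (e : rel T) : {set {set T}} :=
  [set A : {set T} | [exists x, exists y, e x y && (A == [set x; y])]].

Definition edges_within (T : finType) (e : rel T) (S : {set T}) : nat :=
  #|[set A in edges e | A \subset S]|.

(* The finset predicate [partition] forbids empty blocks, so it does not apply:
   here parts are indexed and may be empty. *)
Definition is_kpartition (T : finType) (k : nat) (V : 'I_k -> {set T}) : Prop :=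
  \bigcup_(i < k) V i = [set: T] /\
  (forall i j : 'I_k, i != j -> [disjoint V i & V j]).

Definition balanced (T : finType) (k : nat) (V : 'I_k -> {set T}) : Prop :=
  forall i j : 'I_k, (`|(#|V i|)%:Z - (#|V j|)%:Z| <= 1)%R.

Definition max_pair_edges (T : finType) (e : rel T) (k : nat)
    (V : 'I_k -> {set T}) : nat :=
  \max_(p : 'I_k * 'I_k | (p.1 < p.2)%N) edges_within e (V p.1 :|: V p.2).

Local Open Scope ring_scope.

Definition Cconst (R : rcfType) (k : nat) : R :=
  (k%:R - 2) / k%:R ^+ 2 +
  (k%:R - 2) / (k%:R * (k%:R - 1)) * Num.sqrt (k%:R * (k%:R - 1) - 2).

(* Main.v *)
Require Import Defs.
From mathcomp Require Import all_boot all_order all_algebra all_fingroup.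
From mathcomp Require Import ring lra zify.

Set Implicit Arguments.
Unset Strict Implicit.
Unset Printing Implicit Defensive.

Import Order.TTheory GRing.Theory Num.Theory.
Local Open Scope ring_scope.

(** The partition is found by a second moment argument over a structured random
    choice.  List the vertices by decreasing degree, cut the list into rows of [k]
    consecutive vertices (the last row is completed by isolated dummies), and
    let every row independently receive a uniformly random permutation [w b] of its
    [k] columns; part [i] takes from row [b] the vertex in column [w b i].  Each row
    gives at most one vertex to each part and only the last row can fail to give
    one, so every choice of permutations is balanced.

    Fix [i != j] and let [s] be the indicator of [V_i \cup V_j] minus [2 / k].
    Substituting [s + 2 / k] for the indicator splits [e (V_i \cup V_j)] into
    [4 m / k^2], a linear term [2 / k * \sum_v deg v * s v] and the quadratic term
    [Q = \sum_(uv edge) s u * s v].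

    The linear term is bounded for every choice ([linear_bound]): as [s] has sum
    zero on each row, a row contributes at most a multiple of the spread of its
    degrees, and these spreads telescope along the sorted list.  The result is
    [4 (k - 2) / k^2 * n].

    The quadratic term has mean at most 0 and variance at most [c^2 * m], with
    [c = 2 (k - 2) / (k (k - 1))] ([quad_moments]).  Indeed, grouped by pairs of
    rows, [Q] becomes a sum of pairwise orthogonal random variables
    ([sum_supp_orthogonal]): a centred function of the permutations of some rows is
    orthogonal to every centred function of those of a different set of rows.  Two
    distinct rows contribute at most [c^2] times the number of edges between them
    ([sum_block_form_sqr]), and a single row at most [c^2] times the number of its
    edges ([inner_block]).

    Since the [N = k (k - 1) / 2] centred variables [Q_ij] have mean 0, some choice
    makes all of them at most [sqrt ((N - 1) * c^2 * m)] simultaneously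
    ([exists_all_le_sqrt]), which is [C * sqrt (2 m)] where [C] is the second
    summand of [Cconst].  So all pairs have at most
    [4 m / k^2 + 4 (k - 2) / k^2 * n + C * sqrt (2 m)] edges.  This is at most the
    claimed bound because [3 (k - 2) / k^2 <= C] and [sqrt (2 m) <= n]
    ([final_bound]).  The argument needs [k > 2]; for [k = 2] the bound is [m]. *)

(** * Counting edges by ordered pairs of adjacent vertices *)

Lemma card_adj_within (T : finType) (e : rel T) (S : {set T}) :
  simple_graph e ->
  #|[set p : T * T | [&& e p.1 p.2, p.1 \in S & p.2 \in S]]| =
    (2 * edges_within e S)%N.
Proof.
move=> [esym eirr].
rewrite -sum1_card.
rewrite (partition_big (fun p : T * T => [set p.1; p.2])
  (mem [set A in edges e | A \subset S])) /=; last first.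
  move=> [u v]; rewrite !inE /= => /and3P[uv uS vS]; apply/andP; split.
    by apply/existsP; exists u; apply/existsP; exists v; rewrite uv eqxx.
  by apply/subsetP => w; rewrite !inE => /orP[] /eqP ->.
rewrite mulnC -sum_nat_const; apply: eq_bigr => A.
rewrite !inE => /andP[/existsP[x /existsP[y /andP[xy /eqP ->]]] sAS].
have xS : x \in S by apply: (subsetP sAS); rewrite !inE eqxx.
have yS : y \in S by apply: (subsetP sAS); rewrite !inE eqxx orbT.
have nxy : x != y by apply/eqP => E; move: xy; rewrite E eirr.
rewrite sum1dep_card.
have -> : [set p : T * T | (p \in [set p0 : T * T | [&& e p0.1 p0.2, p0.1 \in S & p0.2 \in S]])
            && ([set p.1; p.2] == [set x; y])] = [set (x, y); (y, x)].
  apply/setP => [[u v]]; rewrite !inE /= !xpair_eqE; apply/idP/idP.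
    case/andP => /and3P[uv _ _] /eqP E.
    have nuv : u != v by apply/eqP => E'; move: uv; rewrite E' eirr.
    have : u \in [set x; y] by rewrite -E !inE eqxx.
    have : v \in [set x; y] by rewrite -E !inE eqxx orbT.
    rewrite !inE => /orP[] /eqP Ev /orP[] /eqP Eu; subst; rewrite ?eqxx ?orbT // in nuv *.
  case/orP => /andP[/eqP -> /eqP ->]; rewrite ?(esym y) xy xS yS /=.
    by rewrite eqxx.
  by rewrite setUC eqxx.
by rewrite cards2 xpair_eqE (eq_sym y) (negbTE nxy).
Qed.

Lemma sum_adj_within (R : pzRingType) (T : finType) (e : rel T) (S : {set T}) :
  simple_graph e ->
  \sum_(u in S) \sum_(v in S) (e u v)%:R = 2 * (edges_within e S)%:R :> R.
Proof.
move=> eG; rewrite -natrM -card_adj_within // -sum1_card natr_sum.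
rewrite (eq_bigl (fun p : T * T => (p.1 \in S) && ((p.2 \in S) && e p.1 p.2))); last first.
  by move=> p; rewrite inE andbC -andbA.
rewrite -(pair_big_dep (mem S) (fun u v => (v \in S) && e u v) (fun _ _ => 1%:R)) /=.
apply: eq_bigr => u _; rewrite [RHS]big_mkcondr; apply: eq_bigr => v _.
by case: (e u v).
Qed.

Lemma edges_withinT (T : finType) (e : rel T) : edges_within e [set: T] = #|edges e|.
Proof. by apply: eq_card => A; rewrite inE subsetT andbT. Qed.

Lemma sum_adj (R : pzRingType) (T : finType) (e : rel T) :
  simple_graph e -> \sum_u \sum_v (e u v)%:R = 2 * #|edges e|%:R :> R.
Proof.
move=> eG; rewrite -edges_withinT -sum_adj_within //.
rewrite [RHS](eq_bigl xpredT); last by move=> u; rewrite inE.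
by apply: eq_bigr => u _; apply: eq_bigl => v; rewrite inE.
Qed.

Lemma twice_edges_le (T : finType) (e : rel T) : simple_graph e ->
  (2 * #|edges e| <= #|T| * #|T|)%N.
Proof.
by move=> eG; rewrite -edges_withinT -card_adj_within // -card_prod max_card.
Qed.

(** * Independent coordinates of a random finite function *)

(** The expectation of [F w] for a uniformly random [w] is written as [\sum_w F w],
    to be compared with multiples of [#|{ffun B -> S}|]. *)

Definition upd (B S : finType) (w : {ffun B -> S}) (b : B) (s : S) :=
  [ffun c => if c == b then s else w c].

(** Resampling one coordinate of a uniform function leaves it uniform: exchanging
    the coordinate with the fresh value is an involution on pairs. *)
Lemma sum_resample (R : pzRingType) (B S : finType) (b : B) (F : {ffun B -> S} -> R) :
  \sum_w \sum_s F (upd w b s) = #|S|%:R * \sum_w F w.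
Proof.
pose h (p : {ffun B -> S} * S) := (upd p.1 b p.2, p.1 b).
have hK : involutive h.
  move=> [w s]; rewrite /h /= ffunE eqxx; congr pair.
  by apply/ffunP => c; rewrite !ffunE; case: eqP => [->|].
rewrite pair_big /= (reindex_inj (inv_inj hK)) /=.
rewrite -(pair_big xpredT xpredT (fun w s => F (upd (upd w b s) b (w b)))) /=.
rewrite mulr_sumr; apply: eq_bigr => w _.
rewrite mulr_natl -sumr_const; apply: eq_bigr => s _; congr F.
by apply/ffunP => c; rewrite !ffunE; case: eqP => [->|].
Qed.

(** It suffices that the conditional mean given all other coordinates vanishes. *)
Lemma sum_resample_eq0 (R : numDomainType) (B S : finType) (b : B) (F : {ffun B -> S} -> R) :
  (forall w, \sum_s F (upd w b s) = 0) -> \sum_w F w = 0.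
Proof.
move=> F0; case: (pickP [pred s : S | true]) => [s0 _|S0]; last first.
  by apply: big1 => w _; have := S0 (w b).
have := sum_resample b F; rewrite big1 // => /esym/eqP.
rewrite mulf_eq0 pnatr_eq0 => /orP[|/eqP//].
by rewrite -[_ == _]negbK -lt0n; case/negP; apply/card_gt0P; exists s0.
Qed.

(** * One row: a uniformly random permutation *)

Lemma perm_pair (T : finType) (i j i' j' : T) : i != j -> i' != j' ->
  exists t : {perm T}, t i = i' /\ t j = j'.
Proof.
move=> nij nij'; exists (tperm i i' * tperm (tperm i i' j) j')%g.
rewrite !permM tpermL tpermL; split=> //.
apply: tpermD; last by rewrite eq_sym.
by rewrite -{2}[i'](tpermL i) (inj_eq perm_inj) eq_sym.
Qed.

Lemma ord_neq_gt1 (k : nat) (i j : 'I_k) : i != j -> (1 < k)%N.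
Proof. by case: k i j => [[]//|[|//]] i j; rewrite !ord1. Qed.

(** Double transitivity of the symmetric group: [(s i, s j)] is uniform over the
    ordered pairs of distinct points.  The double sum over all pairs and all [s] is
    computed twice, reindexing [s] by a permutation or the pair by [s]. *)
Lemma sum_perm_pair (R : comPzRingType) (k : nat) (i j : 'I_k) (g : 'I_k -> 'I_k -> R) :
  i != j ->
  k%:R * (k%:R - 1) * (\sum_(s : 'S_k) g (s i) (s j)) =
    #|{perm 'I_k}|%:R * \sum_a \sum_(c | c != a) g a c.
Proof.
move=> nij.
have E a c : c != a -> \sum_(s : 'S_k) g (s a) (s c) = \sum_(s : 'S_k) g (s i) (s j).
  rewrite eq_sym => nac; have [t [<- <-]] := perm_pair nij nac.
  rewrite [RHS](reindex_inj (mulgI t)) /=.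
  by apply: eq_bigr => s _; rewrite !permM.
transitivity (\sum_a \sum_(c | c != a) \sum_(s : 'S_k) g (s a) (s c)).
  under [RHS]eq_bigr => a _ do
    (under eq_bigr => c nca do rewrite (E _ _ nca); rewrite sumr_const cardC1 card_ord).
  rewrite sumr_const card_ord -mulrnA -[RHS]mulr_natl mulnC natrM.
  by congr (_ * _ * _); rewrite -subn1 natrB //; exact: leq_trans (ltn_ord i).
transitivity (\sum_(s : 'S_k) \sum_a \sum_(c | c != a) g (s a) (s c)).
  rewrite [RHS]exchange_big; apply: eq_bigr => a _ /=.
  by rewrite exchange_big.
transitivity (\sum_(s : 'S_k) \sum_a \sum_(c | c != a) g a c).
  apply: eq_bigr => s _; rewrite [RHS](reindex_inj (@perm_inj _ s)) /=.
  apply: eq_bigr => a _; rewrite [RHS](reindex_inj (@perm_inj _ s)) /=.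
  by apply: eq_bigl => c; rewrite (inj_eq perm_inj).
by rewrite sumr_const mulr_natl.
Qed.

Lemma sum_pair (V : nmodType) (I J : finType) (F : I * J -> V) :
  \sum_p F p = \sum_b \sum_x F (b, x).
Proof. by rewrite pair_bigA; apply: eq_bigr => [[b x]]. Qed.

Lemma sum_offdiag (R : pzRingType) (I : finType) (g : I -> I -> R) :
  \sum_a \sum_(c | c != a) g a c = \sum_a \sum_c g a c - \sum_a g a a.
Proof.
rewrite -sumrB; apply: eq_bigr => a _.
by rewrite [in RHS](bigD1 a) //= [RHS]addrC addKr.
Qed.

(** Column [x] of a row with permutation [s] is taken by part [i] or [j] with
    probability [2 / k]; this is the centred indicator of that event. *)
Definition dev (R : fieldType) (k : nat) (i j : 'I_k) (s : 'S_k) (x : 'I_k) : R :=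
  (x == s i)%:R + (x == s j)%:R - 2 / k%:R.

Lemma sum_mul_dev (R : fieldType) (k : nat) (i j : 'I_k) (s : 'S_k) (w : 'I_k -> R) :
  \sum_x w x * dev R i j s x = w (s i) + w (s j) - 2 / k%:R * \sum_x w x.
Proof.
have D a : \sum_x w x * (x == a)%:R = w a.
  rewrite (bigD1 a) //= eqxx mulr1 big1 ?addr0 // => x /negbTE ->.
  by rewrite mulr0.
under eq_bigr => x _ do rewrite /dev mulrBr mulrDr.
by rewrite sumrB big_split /= !D -mulr_suml mulrC.
Qed.

Lemma sum_const_ord (R : pzSemiRingType) (k : nat) (x : R) :
  \sum_(a < k) x = k%:R * x.
Proof. by rewrite sumr_const card_ord mulr_natl. Qed.

Lemma sum_perm_dev (R : realFieldType) (k : nat) (i j : 'I_k) (x : 'I_k) : i != j ->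
  \sum_(s : 'S_k) dev R i j s x = 0.
Proof.
move=> nij.
have k1 := ord_neq_gt1 nij.
have k0 : k%:R != 0 :> R by rewrite pnatr_eq0; lia.
have k10 : k%:R - 1 != 0 :> R by rewrite subr_eq0 (eqr_nat _ k 1); lia.
have K0 : k%:R * (k%:R - 1) != 0 :> R by rewrite mulf_neq0.
apply: (mulfI K0); rewrite mulr0.
rewrite (sum_perm_pair (fun a c => (x == a)%:R + (x == c)%:R - 2 / k%:R) nij).
rewrite sum_offdiag.
have D : \sum_a (x == a)%:R = 1 :> R.
  by rewrite (bigD1 x) //= eqxx big1 ?addr0 // => y; rewrite eq_sym => /negbTE ->.
under eq_bigr => a _ do rewrite sumrB big_split /= D !sum_const_ord.
rewrite !(sumrB, big_split) /= -!mulr_sumr D !sum_const_ord; field; exact: k0.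
Qed.

(** The covariance matrix of [dev] is [c * (1 - J / k)] with
    [c = 2 (k - 2) / (k (k - 1))] and [J] the all-one matrix, hence at most [c]. *)
Lemma sum_perm_dev_sqr (R : realFieldType) (k : nat) (i j : 'I_k) (w : 'I_k -> R) :
  i != j ->
  \sum_(s : 'S_k) (\sum_x w x * dev R i j s x) ^+ 2 <=
  #|{perm 'I_k}|%:R * (2 * (k%:R - 2) / (k%:R * (k%:R - 1)) * \sum_x w x ^+ 2).
Proof.
move=> nij.
have k1 := ord_neq_gt1 nij.
have k2 : 2 <= k%:R :> R by rewrite ler_nat.
have k0 : k%:R != 0 :> R by rewrite pnatr_eq0; lia.
have k10 : k%:R - 1 != 0 :> R by rewrite subr_eq0 (eqr_nat _ k 1); lia.
under eq_bigr => s _ do rewrite sum_mul_dev.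
set W := \sum_x w x; set V := \sum_x w x ^+ 2.
have K0 : 0 < k%:R * (k%:R - 1) :> R by apply: mulr_gt0; lra.
rewrite -(ler_pM2l K0).
rewrite (sum_perm_pair (fun a c => (w a + w c - 2 / k%:R * W) ^+ 2) nij) sum_offdiag.
rewrite mulrCA ler_wpM2l //.
rewrite [leRHS](_ : _ = 2 * (k%:R - 2) * V); last by field; rewrite k0 k10.
have -> : \sum_a \sum_c (w a + w c - 2 / k%:R * W) ^+ 2 = 2 * k%:R * V - 2 * W ^+ 2.
  transitivity (\sum_a (k%:R * w a ^+ 2 - 2 * W * w a + V)).
    apply: eq_bigr => a _.
    rewrite (eq_bigr (fun c => w c ^+ 2 + ((w a - 2 / k%:R * W) ^+ 2
      + 2 * (w a - 2 / k%:R * W) * w c))); last by move=> c _; ring.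
    by rewrite !big_split /= sum_const_ord -/V -mulr_sumr -/W; field.
  by rewrite big_split /= sumrB sum_const_ord -!mulr_sumr -/W -?/V; ring.
have -> : \sum_a (w a + w a - 2 / k%:R * W) ^+ 2 = 4 * V - 4 / k%:R * W ^+ 2.
  rewrite (eq_bigr (fun a => 4 * w a ^+ 2 - 8 / k%:R * W * w a
    + 4 / k%:R ^+ 2 * W ^+ 2)); last by move=> a _; field.
  by rewrite big_split /= sumrB sum_const_ord -!mulr_sumr -/W -?/V; field.
have : 0 <= (2 - 4 / k%:R) * W ^+ 2.
  apply: mulr_ge0; last exact: sqr_ge0.
  by rewrite subr_ge0 ler_pdivrMr; lra.
lra.
Qed.

(** * The edges inside one row *)

(** The quadratic term between two rows with permutations [s] and [t], [A] being the
    adjacency matrix between their columns; [s = t] gives that of a single row. *)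
Definition block_form (R : fieldType) (k : nat) (i j : 'I_k) (A : 'I_k -> 'I_k -> R)
    (s t : 'S_k) : R :=
  \sum_x \sum_y A x y * dev R i j s x * dev R i j t y.

(** The mean of [block_form i j A s s] over [s] when [A] is symmetric with zero
    diagonal and entries of sum [G]: see the first part of [inner_block]. *)
Definition inner_mean (R : fieldType) (k : nat) (G : R) : R :=
  - (2 * (k%:R - 2) * G / (k%:R ^+ 2 * (k%:R - 1))).

(** The numerical core of [inner_block], for a graph on [k] vertices with [m] edges
    and sum of squared degrees [W].  By the Cauchy-Schwarz bound [4 m^2 <= k W] the
    left-hand side is at least [k^2 m (m + (k^2 - 7 k + 8) / 2)], which is nonnegative
    for [m >= 2] because [(k - 3) (k - 4) >= 0] for integers; for [m = 1]
    the bound [W >= 2 m] is used instead. *)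
Lemma inner_variance_ineq (R : realFieldType) (k m : nat) (W : R) :
  (2 < k)%N -> 2 * m%:R <= W -> 4 * m%:R ^+ 2 <= k%:R * W ->
  0 <= 4 * k%:R * (k%:R - 1) * W + (k%:R ^+ 2 - 16 * k%:R + 16) * m%:R ^+ 2
       + k%:R ^+ 2 / 2 * (k%:R ^+ 2 - 7 * k%:R + 8) * m%:R.
Proof.
move=> k3 W1 W2.
have K3 : 3 <= k%:R :> R by rewrite (ler_nat _ 3).
have K34 : 0 <= (k%:R - 3) * (k%:R - 4) :> R.
  have [->|k4] := eqVneq k 3%N; first by rewrite subrr mul0r.
  have K4 : 4 <= k%:R :> R by rewrite (ler_nat _ 4); lia.
  by apply: mulr_ge0; lra.
set K : R := k%:R in K3 K34 W2 *.
case: m W1 W2 => [|[|m]] W1 W2.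
- rewrite expr0n /= !mulr0 !addr0 in W1 *.
  by rewrite !mulr_ge0 //; lra.
- rewrite expr1n !mulr1 in W1 W2 *.
  have : 0 <= K * (K - 1) * (W - 2) by rewrite !mulr_ge0 //; lra.
  have : 0 <= K ^+ 2 * ((K - 3) * (K - 4)) by rewrite mulr_ge0 // sqr_ge0.
  have : 0 <= K * (K - 3) by rewrite mulr_ge0 //; lra.
  lra.
set M : R := m.+2%:R in W1 W2 *.
have M2 : 2 <= M by rewrite (ler_nat _ 2).
have : 0 <= (K - 1) * (K * W - 4 * M ^+ 2) by rewrite mulr_ge0 //; lra.
have : 0 <= K ^+ 2 * M * (M - 2) by rewrite !mulr_ge0 ?sqr_ge0 //; lra.
have : 0 <= K ^+ 2 * M * ((K - 3) * (K - 4)).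
  by rewrite !(mulr_ge0 _ K34) ?mulr_ge0 ?sqr_ge0 //; lra.
lra.
Qed.

(** Since [dev] is a centred indicator of two columns, the form is
    [2 g(a,c) - 4/k (D a + D c) + 4 G / k^2] at [a = s i], [c = s j], where [D] is
    the degree.  Its second moment is therefore a sum over ordered pairs that
    depends only on [G] and on the sum [W] of the squared degrees. *)
Lemma inner_block (R : realFieldType) (k : nat) (i j : 'I_k) (g : rel 'I_k) :
  i != j -> (2 < k)%N -> simple_graph g ->
  let G : R := \sum_x \sum_y (g x y)%:R in
  let Y s := block_form i j (fun x y => (g x y)%:R) s s - inner_mean k G in
  \sum_s Y s = 0 /\
  \sum_s Y s ^+ 2 <= #|{perm 'I_k}|%:R *
     ((2 * (k%:R - 2) / (k%:R * (k%:R - 1))) ^+ 2 * (2 * G)).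
Proof.
move=> nij k3 gG G Y; have [gsym girr] := gG.
have K3 : 3 <= k%:R :> R by rewrite (ler_nat _ 3).
set K : R := k%:R in K3.
have K0 : K != 0 by rewrite gt_eqF //; lra.
have K1 : K - 1 != 0 by rewrite gt_eqF //; lra.
have KK : 0 < K * (K - 1) by rewrite mulr_gt0 //; lra.
pose D x : R := \sum_y (g x y)%:R.
have DG : \sum_x D x = G by [].
have D' y : \sum_x (g x y)%:R = D y by apply: eq_bigr => x _; rewrite gsym.
(* [nu] is the constant term of the form minus its mean. *)
pose nu : R := G * (6 * K - 8) / (K ^+ 2 * (K - 1)).
pose h a c : R := 2 * (g a c)%:R - 4 / K * (D a + D c) + nu.
have Yh s : Y s = h (s i) (s j).
  rewrite /Y /block_form.
  rewrite (eq_bigr (fun x => ((g x (s i))%:R + (g x (s j))%:R - 2 / K * D x)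
    * dev R i j s x)); last first.
    move=> x _; rewrite -sum_mul_dev mulr_suml; apply: eq_bigr => y _; ring.
  rewrite sum_mul_dev sumrB big_split /= !D' -mulr_sumr DG !girr (gsym (s j) (s i)).
  rewrite !mulr0n /h /nu /inner_mean -/K.
  by field; rewrite K0 K1.
pose W : R := \sum_x D x ^+ 2.
split.
  apply: (mulfI (lt0r_neq0 KK)); rewrite mulr0.
  rewrite (eq_bigr (fun s : 'S_k => h (s i) (s j))); last by move=> s _; exact: Yh.
  rewrite /K sum_perm_pair // sum_offdiag -/K.
  rewrite [X in _ - X](eq_bigr (fun a => nu - 8 / K * D a)); last first.
    by move=> a _; rewrite /h girr mulr0n; ring.
  rewrite [X in X - _](eq_bigr (fun a => - 2 * D a + (K * nu - 4 / K * G))); last first.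
    move=> a _.
    rewrite (eq_bigr (fun c => 2 * (g a c)%:R - 4 / K * D c + (nu - 4 / K * D a))); last first.
      by move=> c _; rewrite /h; ring.
    by rewrite big_split /= sumrB sum_const_ord -!mulr_sumr DG -/(D a) -/K; field.
  rewrite big_split /= !sumrB !sum_const_ord -!mulr_sumr DG -/K /nu.
  by field; rewrite K0 K1.
rewrite -(ler_pM2l KK).
rewrite (eq_bigr (fun s : 'S_k => h (s i) (s j) ^+ 2)); last by move=> s _; rewrite Yh.
rewrite [in leLHS]/K (sum_perm_pair (fun a c => h a c ^+ 2)) // sum_offdiag.
rewrite mulrCA ler_wpM2l // -/K.
rewrite [X in _ - X](eq_bigr (fun a => nu ^+ 2 - 16 / K * nu * D a
    + 64 / K ^+ 2 * D a ^+ 2)); last first.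
  by move=> a _; rewrite /h girr mulr0n; field.
pose T a : R := \sum_c (g a c)%:R * D c.
have TW : \sum_a T a = W.
  rewrite /T exchange_big; apply: eq_bigr => c _ /=.
  by rewrite -mulr_suml D' expr2.
rewrite [X in X - _](eq_bigr (fun a => (4 - 4 * nu + 32 / K ^+ 2 * G) * D a - 16 / K * T a
    + (16 / K ^+ 2 * W - 8 / K * nu * G + K * nu ^+ 2))); last first.
  move=> a _.
  rewrite (eq_bigr (fun c => (4 + 4 * nu - 16 / K * D a) * (g a c)%:R
     - 16 / K * ((g a c)%:R * D c) + (16 / K ^+ 2 * D c ^+ 2
     - 8 / K * (nu - 4 / K * D a) * D c + (nu - 4 / K * D a) ^+ 2))); last first.
    by move=> c _; rewrite /h; case: (g a c); rewrite ?mulr0n ?mulr1n; field.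
  rewrite !(sumrB, big_split) /= sum_const_ord -!mulr_sumr -/(D a) -/(T a) DG -/W -/K.
  by field.
(* Integrality is essential: for [k = 3] the estimate would fail at [m = 3/2]. *)
have [m Gm] : exists m : nat, G = 2 * m%:R.
  by exists #|edges g|; rewrite -sum_adj.
have W1 : 2 * m%:R <= W.
  rewrite -Gm -DG; apply: ler_sum => x _.
  rewrite /D -natr_sum -natrX ler_nat.
  by case: (\sum_(y < k) _)%N => // d; rewrite expnS expn1 leq_pmulr.
have W2 : 4 * m%:R ^+ 2 <= K * W.
  have : 0 <= \sum_x (K * D x - G) ^+ 2 by apply: sumr_ge0 => x _; exact: sqr_ge0.
  rewrite (eq_bigr (fun x => K ^+ 2 * D x ^+ 2 - 2 * K * G * D x + G ^+ 2)); last first.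
    by move=> x _; ring.
  rewrite big_split /= sumrB sum_const_ord -!mulr_sumr DG -/W -/K.
  rewrite (_ : _ + _ = K * (K * W - G ^+ 2)); last by ring.
  rewrite pmulr_rge0; last by lra.
  by rewrite Gm; lra.
have := inner_variance_ineq k3 W1 W2; rewrite -/K.
rewrite !(sumrB, big_split) /= !sum_const_ord -!mulr_sumr TW DG -/W -/K /nu Gm.
set E := (X in 0 <= X -> _) => E0.
rewrite -subr_ge0 [X in 0 <= X](_ : _ = 16 / (K ^+ 3 * (K - 1)) * E); last first.
  by rewrite /E; field; rewrite K0 K1.
by rewrite mulr_ge0 // divr_ge0 // mulr_ge0 ?exprn_ge0 //; lra.
Qed.

(** * Orthogonality of functions of different rows *)

Lemma sum_sqr_orthogonal (R : comPzRingType) (I Om : finType) (P : pred I) (f : I -> Om -> R) :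
  (forall p q, P p -> P q -> p != q -> \sum_w f p w * f q w = 0) ->
  \sum_w (\sum_(p | P p) f p w) ^+ 2 = \sum_(p | P p) \sum_w f p w ^+ 2.
Proof.
move=> ort.
under eq_bigr => w _ do rewrite expr2 mulr_suml.
rewrite exchange_big; apply: eq_bigr => p Pp /=.
under eq_bigr => w _ do rewrite mulr_sumr.
rewrite exchange_big (bigD1 p) //= [X in _ + X]big1 ?addr0.
  by apply: eq_bigr => w _; rewrite expr2.
by move=> q /andP[Pq nqp]; apply: ort; rewrite // eq_sym.
Qed.

(** The orthogonality of the Hoeffding decomposition: resampling a coordinate that
    belongs to only one of the two supports kills that factor and fixes the other. *)
Lemma sum_supp_orthogonal (R : numDomainType) (B S : finType)
    (A A' : {set B}) (f f' : {ffun B -> S} -> R) :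
  (forall b w s, b \notin A -> f (upd w b s) = f w) ->
  (forall b w s, b \notin A' -> f' (upd w b s) = f' w) ->
  (forall b w, b \in A -> \sum_s f (upd w b s) = 0) ->
  (forall b w, b \in A' -> \sum_s f' (upd w b s) = 0) ->
  A != A' -> \sum_w f w * f' w = 0.
Proof.
move=> fA fA' f0 f0'; rewrite eqEsubset negb_and.
case/orP => /subsetPn[b bA bA']; apply: (sum_resample_eq0 (b := b)) => w.
  under eq_bigr => s _ do rewrite fA' //.
  by rewrite -mulr_suml f0 // mul0r.
under eq_bigr => s _ do rewrite fA //.
by rewrite -mulr_sumr f0' // mulr0.
Qed.

Lemma sum_offdiag_lt (V : nmodType) (r : nat) (G : 'I_r -> 'I_r -> V) :
  \sum_b \sum_(c | c != b) G b c =
  \sum_(p : 'I_r * 'I_r | (p.1 < p.2)%N) (G p.1 p.2 + G p.2 p.1).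
Proof.
rewrite big_split /= pair_big_dep /=.
rewrite (bigID (fun p : 'I_r * 'I_r => (p.1 < p.2)%N)) /=; congr (_ + _).
  by apply: eq_bigl => p; rewrite -(inj_eq val_inj) /=; lia.
pose sw (p : 'I_r * 'I_r) := (p.2, p.1).
have swK : involutive sw by case.
rewrite (reindex_inj (inv_inj swK)) /=.
by apply: eq_bigl => p; rewrite -(inj_eq val_inj) /=; lia.
Qed.

Lemma sum_diag_lt (V : nmodType) (r : nat) (G : 'I_r -> 'I_r -> V) :
  \sum_(p : 'I_r * 'I_r | (p.1 <= p.2)%N) G p.1 p.2 =
  \sum_b G b b + \sum_(p : 'I_r * 'I_r | (p.1 < p.2)%N) G p.1 p.2.
Proof.
rewrite (bigID (fun p : 'I_r * 'I_r => p.1 == p.2)) /=; congr (_ + _); last first.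
  by apply: eq_bigl => p; rewrite -(inj_eq val_inj) /=; lia.
rewrite (reindex_omap (fun b : 'I_r => (b, b))
  (fun p => if p.1 == p.2 then Some p.1 else None)) /=.
  by apply: eq_bigl => b; rewrite leqnn !eqxx.
by move=> [b c] /= /andP[_ /eqP ->]; rewrite eqxx.
Qed.

Lemma sum_ffun1 (R : pzRingType) (B S : finType) (b : B) (F : S -> R) :
  #|S|%:R * \sum_(w : {ffun B -> S}) F (w b) = #|{ffun B -> S}|%:R * \sum_s F s.
Proof.
rewrite -(sum_resample b (fun w => F (w b))).
under eq_bigr => w _ do under eq_bigr => s _ do rewrite ffunE eqxx.
by rewrite sumr_const mulr_natl.
Qed.

Lemma sum_ffun2 (R : pzRingType) (B S : finType) (b c : B) (F : S -> S -> R) :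
  b != c ->
  #|S|%:R * (#|S|%:R * \sum_(w : {ffun B -> S}) F (w b) (w c)) =
  #|{ffun B -> S}|%:R * \sum_s \sum_t F s t.
Proof.
move=> nbc; rewrite -(sum_resample b (fun w => F (w b) (w c))).
under eq_bigr => w _ do
  under eq_bigr => s _ do rewrite !ffunE eqxx eq_sym (negbTE nbc).
rewrite exchange_big /= mulr_sumr [RHS]mulr_sumr.
by apply: eq_bigr => s _; exact: sum_ffun1.
Qed.

(** * Making many centred variables small simultaneously *)

(** The bound is that of extremal sequences: [N] numbers with sum 0 and sum of
    squares [N S] are at most [sqrt ((N - 1) S)].  The sums [\sum_p q p w] vanish
    only on average over [w], so the argument shifts by the common value [- t]
    that the remaining numbers have in the extremal case: the mean over [w] of
    [\sum_p (q p w + t)^2] is at most [N^2 t^2], and at a minimizing [w] each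
    summand is at most this. *)
Lemma exists_all_le_sqrt (R : rcfType) (Om I : finType) (w0 : Om) (P : pred I)
    (q : I -> Om -> R) (S : R) :
  (1 < #|P|)%N -> 0 <= S ->
  (forall p, P p -> \sum_w q p w = 0) ->
  (forall p, P p -> \sum_w q p w ^+ 2 <= #|Om|%:R * S) ->
  exists w, forall p, P p -> q p w <= Num.sqrt (S * (#|P|%:R - 1)).
Proof.
move=> P1 S0 q0 q2; set N : R := #|P|%:R.
have N2 : 2 <= N by rewrite /N (ler_nat _ 2).
have N1 : N - 1 != 0 by rewrite gt_eqF //; lra.
have N0 : 0 < N - 1 by lra.
pose t := Num.sqrt (S / (N - 1)).
have t0 : 0 <= t by exact: sqrtr_ge0.
have t2 : (N - 1) * t ^+ 2 = S by rewrite /t sqr_sqrtr; [field|rewrite divr_ge0 // ltW].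
have -> : Num.sqrt (S * (N - 1)) = (N - 1) * t.
  by rewrite -t2 mulrAC -expr2 -exprMn sqrtr_sqr ger0_norm // mulr_ge0 // ltW.
pose Phi w := \sum_(p | P p) (q p w + t) ^+ 2.
case: (@arg_minP _ _ _ w0 xpredT Phi isT) => w _ wmin.
have Om0 : 0 < #|Om|%:R :> R by rewrite ltr0n; apply/card_gt0P; exists w0.
have Phiw : Phi w <= N ^+ 2 * t ^+ 2.
  rewrite -(ler_pM2l Om0) mulr_natl -sumr_const.
  apply: (le_trans (ler_sum _ (fun v _ => wmin v isT))).
  rewrite /Phi exchange_big /=.
  have -> : #|Om|%:R * (N ^+ 2 * t ^+ 2) = \sum_(p | P p) #|Om|%:R * (S + t ^+ 2).
    by rewrite sumr_const -[RHS]mulr_natl -/N -t2; ring.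
  apply: ler_sum => p Pp.
  rewrite (eq_bigr (fun v => q p v ^+ 2 + (2 * t * q p v + t ^+ 2))); last by move=> v _; ring.
  rewrite !big_split /= -mulr_sumr q0 // sumr_const -[X in _ + (_ + X)]mulr_natl.
  by rewrite mulr0 add0r mulrDr lerD2r q2.
exists w => p Pp; rewrite leNgt; apply/negP => lt.
have : (q p w + t) ^+ 2 <= (N * t) ^+ 2.
  rewrite exprMn; apply: le_trans Phiw; rewrite /Phi (bigD1 p) //= lerDl.
  by apply: sumr_ge0 => *; exact: sqr_ge0.
have Nt0 : 0 <= N * t by rewrite mulr_ge0 //; lra.
rewrite ler_sqr ?nnegrE //; lra.
Qed.

(** * The linear term *)

(** Of the [k] entries of [d] two are taken and the sum of all has weight [2 / k], so
    the worst case is that of two entries [hi] and all others [lo]. *)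
Lemma block_linear (R : realFieldType) (k : nat) (i j : 'I_k) (s : 'S_k)
    (d : 'I_k -> R) (lo hi : R) :
  i != j -> (forall x, lo <= d x <= hi) ->
  \sum_x d x * dev R i j s x <= 2 * (k%:R - 2) / k%:R * (hi - lo).
Proof.
move=> nij dlh.
have k1 := ord_neq_gt1 nij.
have k2 : 2 <= k%:R :> R by rewrite ler_nat.
set K : R := k%:R in k2 *.
have K0 : K != 0 by rewrite gt_eqF //; lra.
have ns : s j != s i by rewrite (inj_eq perm_inj) eq_sym.
rewrite sum_mul_dev -/K.
have : d (s i) + d (s j) + (K - 2) * lo <= \sum_x d x.
  have -> : \sum_x d x = K * lo + \sum_x (d x - lo).
    by rewrite sumrB sum_const_ord -/K; ring.
  rewrite (bigD1 (s i)) //= (bigD1 (s j)) //=.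
  have : 0 <= \sum_(x | (x != s i) && (x != s j)) (d x - lo).
    by apply: sumr_ge0 => x _; rewrite subr_ge0; case/andP: (dlh x).
  lra.
have /andP[_ hi1] := dlh (s i); have /andP[_ hj1] := dlh (s j).
move=> Sd.
have : 2 / K * (d (s i) + d (s j) + (K - 2) * lo) <= 2 / K * \sum_x d x.
  by rewrite ler_wpM2l // divr_ge0 //; lra.
have : 0 <= (K - 2) / K * ((hi - d (s i)) + (hi - d (s j))).
  by rewrite mulr_ge0 // ?divr_ge0 //; lra.
have -> : 2 * (K - 2) / K * (hi - lo) = (K - 2) / K * ((hi - d (s i)) + (hi - d (s j)))
   + (d (s i) + d (s j)) - 2 / K * (d (s i) + d (s j) + (K - 2) * lo) by field.
lra.
Qed.

(** With [H] evaluated at the row boundaries of a sorted degree sequence, the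
    spreads [H b - H b.+1] of the rows telescope. *)
Lemma linear_bound (R : realFieldType) (k r : nat) (i j : 'I_k)
    (w : {ffun 'I_r -> 'S_k}) (d : 'I_r -> 'I_k -> R) (H : nat -> R) :
  i != j -> 0 <= H r -> (forall (b : 'I_r) x, H b.+1 <= d b x <= H b) ->
  \sum_b \sum_x d b x * dev R i j (w b) x <= 2 * (k%:R - 2) / k%:R * H 0%N.
Proof.
move=> nij Hr dH.
have k2 : 2 <= k%:R :> R by rewrite ler_nat (ord_neq_gt1 nij).
apply: (@le_trans _ _ (\sum_(b < r) 2 * (k%:R - 2) / k%:R * (H b - H b.+1))).
  by apply: ler_sum => b _; exact: block_linear.
rewrite -mulr_sumr ler_wpM2l //; first by rewrite divr_ge0 ?mulr_ge0 //; lra.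
have -> : \sum_(b < r) (H b - H b.+1) = H 0%N - H r; last by lra.
elim: r {w d Hr dH} => [|r IH]; first by rewrite big_ord0 subrr.
by rewrite big_ord_recr /= IH; ring.
Qed.

(** * The quadratic term *)

Lemma block_formC (R : fieldType) (k : nat) (i j : 'I_k) (A B : 'I_k -> 'I_k -> R)
    (s t : 'S_k) :
  (forall x y, A x y = B y x) -> block_form i j A s t = block_form i j B t s.
Proof.
move=> AB; rewrite /block_form exchange_big /=.
by apply: eq_bigr => x _; apply: eq_bigr => y _; rewrite AB mulrAC.
Qed.

Lemma sum_block_form (R : realFieldType) (k : nat) (i j : 'I_k) (A : 'I_k -> 'I_k -> R)
    (s : 'S_k) :
  i != j -> \sum_t block_form i j A s t = 0.
Proof.
move=> nij; rewrite exchange_big /=; apply: big1 => x _.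
rewrite exchange_big /=; apply: big1 => y _.
by rewrite -mulr_sumr sum_perm_dev // mulr0.
Qed.

(** The one-row estimate applied twice: first to [t] with the weights obtained from
    [s], then to [s] for each column of [A]. *)
Lemma sum_block_form_sqr (R : realFieldType) (k : nat) (i j : 'I_k) (A : 'I_k -> 'I_k -> R) :
  i != j ->
  \sum_s \sum_t block_form i j A s t ^+ 2 <=
  #|{perm 'I_k}|%:R * (#|{perm 'I_k}|%:R *
    ((2 * (k%:R - 2) / (k%:R * (k%:R - 1))) ^+ 2 * \sum_x \sum_y A x y ^+ 2)).
Proof.
move=> nij.
have k2 : 2 <= k%:R :> R by rewrite ler_nat (ord_neq_gt1 nij).
set c := _ / _; set F : R := #|_|%:R.
have c0 : 0 <= c by rewrite divr_ge0 ?mulr_ge0 //; lra.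
have F0 : 0 <= F by exact: ler0n.
have step s : \sum_t block_form i j A s t ^+ 2 <=
    F * (c * \sum_y (\sum_x A x y * dev R i j s x) ^+ 2).
  rewrite (eq_bigr (fun t => (\sum_y (\sum_x A x y * dev R i j s x) * dev R i j t y) ^+ 2)).
    exact: sum_perm_dev_sqr.
  move=> t _; congr (_ ^+ 2); rewrite /block_form exchange_big /=.
  by apply: eq_bigr => y _; rewrite mulr_suml.
apply: (le_trans (ler_sum _ (fun s _ => step s))).
rewrite -!mulr_sumr ler_wpM2l // expr2 -mulrA [leRHS]mulrCA ler_wpM2l //.
rewrite exchange_big [X in _ * (_ * X)]exchange_big /= 2!mulr_sumr; apply: ler_sum => y _.
exact: sum_perm_dev_sqr.
Qed.

(** Summed over ordered pairs of vertices, so this is twice the quadratic term. *)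
Definition quad (R : fieldType) (r k : nat) (i j : 'I_k) (a : rel ('I_r * 'I_k))
    (w : {ffun 'I_r -> 'S_k}) : R :=
  \sum_b \sum_c block_form i j (fun x y => (a (b, x) (c, y))%:R) (w b) (w c).

Definition quad_mean (R : fieldType) (r k : nat) (a : rel ('I_r * 'I_k)) : R :=
  \sum_b inner_mean k (\sum_x \sum_y (a (b, x) (b, y))%:R).

(** The component of the centred [quad] that depends on rows [b] and [c], each
    unordered pair of rows being counted once, at [b <= c]. *)
Definition quad_part (R : fieldType) (r k : nat) (i j : 'I_k) (a : rel ('I_r * 'I_k))
    (b c : 'I_r) (w : {ffun 'I_r -> 'S_k}) : R :=
  if b == c then
    block_form i j (fun x y => (a (b, x) (b, y))%:R) (w b) (w b)
    - inner_mean k (\sum_x \sum_y (a (b, x) (b, y))%:R)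
  else 2 * block_form i j (fun x y => (a (b, x) (c, y))%:R) (w b) (w c).

Lemma quad_decomp (R : fieldType) (r k : nat) (i j : 'I_k) (a : rel ('I_r * 'I_k))
    (w : {ffun 'I_r -> 'S_k}) : symmetric a ->
  quad R i j a w - quad_mean R a =
  \sum_(p : 'I_r * 'I_r | (p.1 <= p.2)%N) quad_part R i j a p.1 p.2 w.
Proof.
move=> asym; rewrite (sum_diag_lt (fun b c => quad_part R i j a b c w)).
have E b : quad_part R i j a b b w =
    block_form i j (fun x y => (a (b, x) (b, y))%:R) (w b) (w b)
    - inner_mean k (\sum_x \sum_y (a (b, x) (b, y))%:R) by rewrite /quad_part eqxx.
under [in RHS]eq_bigr => b _ do rewrite E.
rewrite sumrB -/(quad_mean R a) addrAC; congr (_ - _).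
rewrite /quad; under eq_bigr => b _ do rewrite (bigD1 b) //=.
rewrite big_split /= sum_offdiag_lt; congr (_ + _).
apply: eq_bigr => [[b c]] /= bc; rewrite /quad_part -(inj_eq val_inj) ltn_eqF //.
by rewrite mulr_natl mulr2n; congr (_ + _); apply: block_formC => x y; rewrite asym.
Qed.

Lemma quad_part_upd (R : fieldType) (r k : nat) (i j : 'I_k) (a : rel ('I_r * 'I_k))
    (b c x : 'I_r) (w : {ffun 'I_r -> 'S_k}) (s : 'S_k) :
  x \notin [set b; c] -> quad_part R i j a b c (upd w x s) = quad_part R i j a b c w.
Proof.
rewrite !inE negb_or => /andP[xb xc].
by rewrite /quad_part !ffunE ![_ == x]eq_sym (negbTE xb) (negbTE xc).
Qed.

Lemma simple_block (r k : nat) (a : rel ('I_r * 'I_k)) (b : 'I_r) :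
  simple_graph a -> simple_graph (fun x y => a (b, x) (b, y)).
Proof. by case=> asym airr; split=> [x y|x]; [exact: asym | exact: airr]. Qed.

Lemma quad_part_center (R : realFieldType) (r k : nat) (i j : 'I_k) (a : rel ('I_r * 'I_k))
    (b c x : 'I_r) (w : {ffun 'I_r -> 'S_k}) :
  i != j -> (2 < k)%N -> simple_graph a ->
  x \in [set b; c] -> \sum_s quad_part R i j a b c (upd w x s) = 0.
Proof.
move=> nij k3 aG; rewrite /quad_part; have [<-|nbc] := eqVneq b c.
  rewrite setUid inE => /eqP ->.
  rewrite -[RHS](inner_block R nij k3 (simple_block b aG)).1.
  by apply: eq_bigr => s _; rewrite !ffunE eqxx.
rewrite !inE -mulr_sumr => /orP[] /eqP ->; rewrite -[RHS](mulr0 2); congr (_ * _).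
  rewrite -[RHS](sum_block_form (fun x y => (a (c, x) (b, y))%:R) (w c) nij).
  apply: eq_bigr => s _; rewrite !ffunE eqxx eq_sym (negbTE nbc).
  by apply: block_formC => y z; rewrite aG.1.
rewrite -[RHS](sum_block_form (fun x y => (a (b, x) (c, y))%:R) (w b) nij).
by apply: eq_bigr => s _; rewrite !ffunE eqxx (negbTE nbc).
Qed.

Lemma sum_quad_part_sqr (R : realFieldType) (r k : nat) (i j : 'I_k) (a : rel ('I_r * 'I_k))
    (b c : 'I_r) :
  i != j -> (2 < k)%N -> simple_graph a ->
  \sum_(w : {ffun 'I_r -> 'S_k}) quad_part R i j a b c w ^+ 2 <=
  #|{ffun 'I_r -> 'S_k}|%:R *
    (2 * (2 * (k%:R - 2) / (k%:R * (k%:R - 1))) ^+ 2 *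
     (if b == c then 1 else 2) * \sum_x \sum_y (a (b, x) (c, y))%:R).
Proof.
move=> nij k3 aG; rewrite /quad_part.
set F : R := #|_|%:R; set e := _ / _.
have P0 : 0 < #|{perm 'I_k}|%:R :> R by rewrite ltr0n; apply/card_gt0P; exists 1%g.
have F0 : 0 <= F by exact: ler0n.
have [<-|nbc] := eqVneq b c.
  rewrite -(ler_pM2l P0) (sum_ffun1 b (fun s => (block_form i j _ s s - _) ^+ 2)).
  rewrite -/F [leRHS]mulrCA ler_wpM2l //.
  apply: le_trans (inner_block R nij k3 (simple_block b aG)).2 _.
  by rewrite -/e ler_wpM2l ?(ltW P0) //; lra.
rewrite -(ler_pM2l P0) -(ler_pM2l P0).
rewrite (sum_ffun2 (fun s t => (2 * block_form i j _ s t) ^+ 2) nbc) -/F.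
under eq_bigr => s _ do (under eq_bigr => t _ do rewrite exprMn; rewrite -mulr_sumr).
rewrite -mulr_sumr.
have -> G : #|{perm 'I_k}|%:R * (#|{perm 'I_k}|%:R * (F * (2 * e ^+ 2 * 2 * G))) =
  F * (2 ^+ 2 * (#|{perm 'I_k}|%:R * (#|{perm 'I_k}|%:R * (e ^+ 2 * G)))) by ring.
rewrite ler_wpM2l // ler_wpM2l ?exprn_ge0 //.
apply: le_trans (sum_block_form_sqr _ nij) _.
rewrite -/e !ler_wpM2l ?sqr_ge0 ?(ltW P0) //.
apply: ler_sum => x _; apply: ler_sum => y _.
by case: (a _ _); rewrite ?expr1n ?expr0n.
Qed.

Lemma set2_lt_inj (r : nat) (p q : 'I_r * 'I_r) :
  (p.1 <= p.2)%N -> (q.1 <= q.2)%N -> p != q -> [set p.1; p.2] != [set q.1; q.2].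
Proof.
case: p q => [b c] [b' c'] /= bc bc'; apply: contraNneq => E.
have: b \in [set b'; c'] by rewrite -E !inE eqxx.
have: c \in [set b'; c'] by rewrite -E !inE eqxx orbT.
have: b' \in [set b; c] by rewrite E !inE eqxx.
have: c' \in [set b; c] by rewrite E !inE eqxx orbT.
rewrite !inE xpair_eqE -!(inj_eq val_inj) /=; lia.
Qed.

(** Supports [[set b; c]] of the components differ for different pairs [b <= c], so
    the variance is the sum of the variances of the components. *)
Lemma quad_moments (R : realFieldType) (r k : nat) (i j : 'I_k) (a : rel ('I_r * 'I_k)) :
  i != j -> (2 < k)%N -> simple_graph a ->
  \sum_w (quad R i j a w - quad_mean R a) = 0 /\
  \sum_w (quad R i j a w - quad_mean R a) ^+ 2 <=
  #|{ffun 'I_r -> 'S_k}|%:R *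
    (2 * (2 * (k%:R - 2) / (k%:R * (k%:R - 1))) ^+ 2 * \sum_p \sum_q (a p q)%:R).
Proof.
move=> nij k3 aG.
under eq_bigr => w _ do rewrite (quad_decomp _ _ _ _ aG.1).
under [X in _ /\ X <= _]eq_bigr => w _ do rewrite (quad_decomp _ _ _ _ aG.1).
split.
  rewrite exchange_big big1 //= => p _; apply: (sum_resample_eq0 (b := p.1)) => w.
  by apply: quad_part_center => //; rewrite !inE eqxx.
rewrite sum_sqr_orthogonal; last first.
  move=> p q pp qq npq.
  apply: (@sum_supp_orthogonal _ _ _ [set p.1; p.2] [set q.1; q.2]).
  - by move=> b w s; exact: quad_part_upd.
  - by move=> b w s; exact: quad_part_upd.
  - by move=> b w; exact: quad_part_center.
  - by move=> b w; exact: quad_part_center.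
  - exact: set2_lt_inj.
apply: (le_trans (ler_sum _ (fun p _ => sum_quad_part_sqr R p.1 p.2 nij k3 aG))).
rewrite -mulr_sumr ler_wpM2l // ?ler0n //.
set e := 2 * _; under eq_bigr => p _ do rewrite -mulrA.
rewrite -mulr_sumr ler_wpM2l //.
  by rewrite /e mulr_ge0 // sqr_ge0.
pose G b c : R := \sum_x \sum_y (a (b, x) (c, y))%:R.
have -> : \sum_p \sum_q (a p q)%:R = \sum_b \sum_c G b c.
  rewrite sum_pair; apply: eq_bigr => b _.
  by rewrite [RHS]exchange_big; apply: eq_bigr => x _; rewrite sum_pair.
rewrite (sum_diag_lt (fun b c => (if b == c then 1 else 2) * G b c)).
under eq_bigr => b _ do rewrite eqxx mul1r.
under [X in _ <= X]eq_bigr => b _ do rewrite (bigD1 b) //=.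
rewrite big_split /= sum_offdiag_lt lerD2l.
apply: ler_sum => [[b c]] /= bc; rewrite -(inj_eq val_inj) ltn_eqF //.
have -> : G c b = G b c; last by rewrite mulr_natl mulr2n.
rewrite /G exchange_big; apply: eq_bigr => x _; apply: eq_bigr => y _.
by rewrite aG.1.
Qed.

(** * A good choice of permutations *)

Lemma card_lt_pairs (k : nat) : #|[pred p : 'I_k * 'I_k | (p.1 < p.2)%N]| = 'C(k, 2).
Proof.
rewrite -bin2_sum big_mkord -sum1_card.
rewrite -(pair_big_dep xpredT (fun b c : 'I_k => (b < c)%N) (fun _ _ => 1%N)) /=.
rewrite (exchange_big_dep xpredT) //=; apply: eq_bigr => c _.
rewrite sum1_card.
rewrite -[RHS]card_ord -(card_image (f := widen_ord (ltnW (ltn_ord c)))); last first.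
  by move=> x y /(congr1 val) /= /val_inj.
apply: eq_card => b; apply/idP/imageP.
  rewrite unfold_in => bc; exists (Ordinal bc); rewrite ?inE //; exact: ord_inj.
by case=> x _ ->; rewrite unfold_in; exact: (ltn_ord x).
Qed.

Lemma quad_mean_le0 (R : realFieldType) (r k : nat) (a : rel ('I_r * 'I_k)) :
  (2 < k)%N -> quad_mean R a <= 0.
Proof.
move=> k3; have K3 : 3 <= k%:R :> R by rewrite (ler_nat _ 3).
apply: sumr_le0 => b _; rewrite oppr_le0 divr_ge0 //.
  rewrite mulr_ge0 ?mulr_ge0 //; first lra.
  by do 2!apply: sumr_ge0 => ? _; exact: ler0n.
by rewrite mulr_ge0 ?sqr_ge0 //; lra.
Qed.

(** Indicator of the union of parts [i] and [j], provided that [i != j]. *)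
Definition chosen (R : pzRingType) (r k : nat) (w : {ffun 'I_r -> 'S_k}) (i j : 'I_k)
    (p : 'I_r * 'I_k) : R :=
  (p.2 == w p.1 i)%:R + (p.2 == w p.1 j)%:R.

(** Both indicators are replaced by [dev + 2 / k]; by symmetry the two mixed terms
    agree and form the linear term. *)
Lemma sum_form_dev (R : realFieldType) (r k : nat) (i j : 'I_k) (a : rel ('I_r * 'I_k))
    (w : {ffun 'I_r -> 'S_k}) : symmetric a ->
  \sum_p \sum_q (a p q)%:R * chosen R w i j p * chosen R w i j q =
  quad R i j a w
  + 4 / k%:R * (\sum_b \sum_x (\sum_q (a (b, x) q)%:R) * dev R i j (w b) x)
  + 4 / k%:R ^+ 2 * \sum_p \sum_q (a p q)%:R.
Proof.
move=> asym; pose s p := dev R i j (w p.1) p.2.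
have -> : quad R i j a w = \sum_p \sum_q (a p q)%:R * s p * s q.
  rewrite sum_pair; apply: eq_bigr => b _.
  by rewrite /block_form exchange_big; apply: eq_bigr => x _; rewrite sum_pair.
rewrite -(sum_pair (fun p => (\sum_q (a p q)%:R) * s p)).
have S2 : \sum_p (\sum_q (a p q)%:R) * s p = \sum_p \sum_q (a p q)%:R * s q.
  rewrite exchange_big; apply: eq_bigr => p _ /=.
  by rewrite mulr_suml; apply: eq_bigr => q _; rewrite asym.
rewrite (_ : 4 / k%:R = 2 / k%:R + 2 / k%:R :> R); last by lra.
rewrite [(_ + _) * _]mulrDl {2}S2 !mulr_sumr -!big_split /=; apply: eq_bigr => p _.
rewrite mulr_suml !mulr_sumr -!big_split /=; apply: eq_bigr => q _.
by rewrite /s /dev /chosen !expr2 invfM; ring.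
Qed.

(** The left-hand side counts every edge inside the two parts twice, hence the
    factor 2. *)
Lemma exists_good_perms (R : rcfType) (r k m : nat) (a : rel ('I_r * 'I_k)) (H : nat -> R) :
  (2 < k)%N -> simple_graph a -> \sum_p \sum_q (a p q)%:R = 2 * m%:R :> R ->
  0 <= H r ->
  (forall (b : 'I_r) x, H b.+1 <= \sum_q (a (b, x) q)%:R <= H b) ->
  exists w : {ffun 'I_r -> 'S_k}, forall i j : 'I_k, (i < j)%N ->
      \sum_p \sum_q (a p q)%:R * chosen R w i j p * chosen R w i j q <=
    2 * (4 * m%:R / k%:R ^+ 2 + 4 * (k%:R - 2) / k%:R ^+ 2 * H 0%N
         + (k%:R - 2) / (k%:R * (k%:R - 1)) * Num.sqrt (k%:R * (k%:R - 1) - 2)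
           * Num.sqrt (2 * m%:R)).
Proof.
move=> k3 aG am Hr aH.
have K3 : 3 <= k%:R :> R by rewrite (ler_nat _ 3).
set K : R := k%:R in K3 *.
have K0 : K != 0 by rewrite gt_eqF //; lra.
have K1 : K - 1 != 0 by rewrite gt_eqF //; lra.
set e : R := (K - 2) / (K * (K - 1)).
have e0 : 0 <= e by rewrite divr_ge0 ?mulr_ge0 //; lra.
have KK : 0 <= K * (K - 1) - 2.
  by rewrite (_ : _ - _ = (K - 2) * (K + 1)) ?mulr_ge0 //; [lra | lra | ring].
pose P := [pred p : 'I_k * 'I_k | (p.1 < p.2)%N].
have NP : #|P|%:R = K * (K - 1) / 2.
  have : (2 * 'C(k, 2))%:R = (k * k.-1)%:R :> R.
    by congr (_%:R); rewrite -(mul_bin_diag k 1) bin1.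
  rewrite card_lt_pairs !natrM -/K (_ : k.-1%:R = K - 1 :> R); first by move=> <-; field.
  by rewrite -subn1 natrB //; lia.
pose S : R := 2 * (2 * (K - 2) / (K * (K - 1))) ^+ 2 * (2 * m%:R).
have nP p : P p -> p.1 != p.2 by rewrite /P /= -(inj_eq val_inj) /= => /ltn_eqF ->.
have [||p Pp|p Pp|w wP] := @exists_all_le_sqrt R {ffun 'I_r -> 'S_k} _ [ffun=> 1%g] P
   (fun p w => quad R p.1 p.2 a w - quad_mean R a) S.
- rewrite -(ltr_nat R) NP ltr_pdivlMr // mul1r.
  have : 0 <= (K - 3) * (K + 2) by rewrite mulr_ge0 //; lra.
  lra.
- by rewrite /S; apply: mulr_ge0; apply: mulr_ge0; rewrite ?sqr_ge0 ?ler0n.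
- exact: (quad_moments R (nP p Pp) k3 aG).1.
- by have := (quad_moments R (nP p Pp) k3 aG).2; rewrite am.
exists w => i j ij; rewrite (sum_form_dev R i j w aG.1) am.
have nij : i != j by rewrite -(inj_eq val_inj) /= ltn_eqF.
have := linear_bound w nij Hr aH; have := wP (i, j) ij; rewrite /= NP.
have -> : S * (K * (K - 1) / 2 - 1) = (2 * e) ^+ 2 * ((K * (K - 1) - 2) * (2 * m%:R)).
  by rewrite /S /e; field; rewrite K0 K1.
rewrite [Num.sqrt (_ ^+ 2 * _)]sqrtrM ?sqr_ge0 // sqrtr_sqr ger0_norm; last by rewrite mulr_ge0.
rewrite [Num.sqrt ((_ - _) * _)]sqrtrM //.
have := quad_mean_le0 R a k3.
set L := \sum_b _; set Q := quad _ _ _ _ _; set s1 := Num.sqrt _; set s2 := Num.sqrt _.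
rewrite -/K => mean Qle Lle.
have : 4 / K * L <= 4 / K * (2 * (K - 2) / K * H 0%N).
  by rewrite ler_wpM2l // divr_ge0 //; lra.
have -> : 4 / K * (2 * (K - 2) / K * H 0%N) = 2 * (4 * (K - 2) / K ^+ 2 * H 0%N).
  by field.
lra.
Qed.

(** * Comparison with the stated bound *)

(** Equality holds at [k = 3]; after squaring, the difference has the factor
    [k - 3]. *)
Lemma Cconst_slope (R : rcfType) (k : nat) : (2 < k)%N ->
  3 * (k%:R - 2) / k%:R ^+ 2 <=
  (k%:R - 2) / (k%:R * (k%:R - 1)) * Num.sqrt (k%:R * (k%:R - 1) - 2) :> R.
Proof.
move=> k3; have K3 : 3 <= k%:R :> R by rewrite (ler_nat _ 3).
set K : R := k%:R in K3 *.
have K0 : K != 0 by rewrite gt_eqF //; lra.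
have K1 : K - 1 != 0 by rewrite gt_eqF //; lra.
have -> : 3 * (K - 2) / K ^+ 2 = (K - 2) / (K * (K - 1)) * (3 * (K - 1) / K).
  by field; rewrite K0 K1.
rewrite ler_wpM2l //; first by rewrite divr_ge0 ?mulr_ge0 //; lra.
have t0 : 0 <= 3 * (K - 1) / K by rewrite divr_ge0 ?mulr_ge0 //; lra.
rewrite -[leLHS](ger0_norm t0) -sqrtr_sqr ler_wsqrtr //.
rewrite -subr_ge0.
rewrite (_ : _ - _ = (K - 3) * (K ^+ 3 + 2 * K ^+ 2 - 5 * K + 3) / K ^+ 2); last by field.
rewrite divr_ge0 ?sqr_ge0 // mulr_ge0 //; first lra.
have : 0 <= (K - 3) * K by rewrite mulr_ge0 //; lra.
have : 0 <= K ^+ 3 by rewrite exprn_ge0 //; lra.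
lra.
Qed.

(** Let [c1 = (k - 2) / k^2] and let [c2] be the second summand of [Cconst], so that
    [3 c1 <= c2].  For [s = sqrt (2 m)], [s <= n] gives [(c2 - 3 c1) (n - s) >= 0],
    which turns [4 c1 n + c2 s] into [c1 n + 3 c1 s + c2 n]. *)
Lemma final_bound (R : rcfType) (k n m : nat) (h : R) :
  (2 < k)%N -> h <= n%:R -> (2 * m <= n * n)%N ->
  4 * m%:R / k%:R ^+ 2 + 4 * (k%:R - 2) / k%:R ^+ 2 * h
    + (k%:R - 2) / (k%:R * (k%:R - 1)) * Num.sqrt (k%:R * (k%:R - 1) - 2)
      * Num.sqrt (2 * m%:R) <=
  4 * m%:R / k%:R ^+ 2
    + 3 * (k%:R - 2) / k%:R ^+ 2 * Num.sqrt (2 * m%:R + 1 / 4)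
    + (k%:R - 2) * (2 * k%:R - 5) / 10
    + Cconst R k * n%:R.
Proof.
move=> k3 hn mn; have K3 : 3 <= k%:R :> R by rewrite (ler_nat _ 3).
have slope := Cconst_slope R k3; rewrite /Cconst.
set K : R := k%:R in K3 slope *.
set c2 := (X in _ <= X) in slope *; rewrite -/c2.
set s := Num.sqrt (2 * _); set s' := Num.sqrt (_ + _).
have c10 : 0 <= (K - 2) / K ^+ 2 by rewrite divr_ge0 ?sqr_ge0 //; lra.
have ss' : s <= s' by rewrite ler_wsqrtr // lerDl; lra.
have sn : s <= n%:R.
  rewrite -[leRHS]ger0_norm ?ler0n // -sqrtr_sqr ler_wsqrtr //.
  by rewrite -natrX -natrM ler_nat expnS expn1.
have : 0 <= (c2 - 3 * (K - 2) / K ^+ 2) * (n%:R - s) by rewrite mulr_ge0 // subr_ge0.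
have : 0 <= (K - 2) / K ^+ 2 * (n%:R - h) by rewrite mulr_ge0 // subr_ge0.
have : 0 <= (K - 2) / K ^+ 2 * (s' - s) by rewrite mulr_ge0 // subr_ge0.
have : 0 <= (K - 2) * (2 * K - 5) by rewrite mulr_ge0 //; lra.
lra.
Qed.

Lemma max_pair_edges_le (R : numDomainType) (T : finType) (e : rel T) (k : nat)
    (V : 'I_k -> {set T}) (B : R) : 0 <= B ->
  (forall i j : 'I_k, (i < j)%N -> (edges_within e (V i :|: V j))%:R <= B) ->
  (max_pair_edges e V)%:R <= B.
Proof.
move=> B0 VB; rewrite /max_pair_edges.
apply: (big_ind (fun x : nat => x%:R <= B)) => //; last by case=> i j; exact: VB.
by move=> x y xB yB; rewrite /maxn; case: ifP.
Qed.

(** * Arranging the vertices in rows of length [k] *)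

(** An injection of the vertices into a grid with [k] columns, with its partial
    inverse; the grid points where [vtx] is [None] are the dummies. *)
Record layout (T : finType) (k : nat) := Layout {
  rows : nat;
  vtx : 'I_rows * 'I_k -> option T;
  pos : T -> 'I_rows * 'I_k;
  posK : forall v, vtx (pos v) = Some v;
  vtxK : forall p v, vtx p = Some v -> pos v = p
}.
Arguments vtx {T k} l p.
Arguments pos {T k} l v.
Arguments posK {T k} l v.
Arguments vtxK {T k} l [p v] _.

(** [H b] is the degree at the first place of row [b], and 0 past the end of the
    sorted list.  The last property is the balance: choosing one place in each row
    gives the same number of vertices up to one, for all rows but the last are
    full. *)
Lemma exists_layout (T : finType) (d : T -> nat) (k : nat) : (0 < k)%N ->
  exists (L : layout T k) (H : nat -> nat),
  [/\ H (rows L) = 0, H 0 <= \max_v d v,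
      forall (b : 'I_(rows L)) x, H b.+1 <= oapp d 0 (vtx L (b, x)) <= H b
    & exists q, forall x : 'I_(rows L) -> 'I_k,
        q <= #|[set b | vtx L (b, x b) != None]| <= q.+1 ]%N.
Proof.
move=> k0; pose s := sort (fun u v => d v <= d u)%N (enum T).
have mem_s v : v \in s by rewrite mem_sort mem_enum.
have uniq_s : uniq s by rewrite sort_uniq enum_uniq.
have size_s : size s = #|T| by rewrite size_sort -cardE.
(* One more row than [#|T| %/ k]; it may consist of dummies only. *)
pose q := (#|T| %/ k)%N.
pose vt (p : 'I_q.+1 * 'I_k) := onth s (p.1 * k + p.2).
have idx_lt v : (index v s < #|T|)%N by rewrite -size_s index_mem.
pose ps v : 'I_q.+1 * 'I_k := (inord (index v s %/ k), Ordinal (ltn_pmod (index v s) k0)).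
have pos1 v : (ps v).1 = (index v s %/ k)%N :> nat.
  by rewrite /= inordK // ltnS leq_div2r // ltnW.
pose D t := oapp d 0%N (onth s t).
have DE t : D t = nth 0%N (map d s) t.
  rewrite /D; have [lt|ge] := ltnP t (size s); last first.
    by rewrite nth_default ?size_map // onth_default.
  case: (s) lt => // x0 s' lt.
  by rewrite onthE !(nth_map x0).
have D_le t t' : (t <= t')%N -> (D t' <= D t)%N.
  rewrite !DE => tt'; have [lt|ge] := ltnP t' (size s); last first.
    by rewrite nth_default ?size_map.
  have srt : sorted geq (map d s).
    by rewrite sorted_map; apply: sort_sorted => u v; exact: leq_total.
  have geq_trans : transitive geq by move=> x y z xy yz; exact: leq_trans yz xy.
  have := sorted_leq_nth geq_trans leqnn 0%N srt.
  by apply; rewrite ?inE ?size_map // (leq_ltn_trans tt').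
have vtx_None p : (vt p != None) = (p.1 * k + p.2 < #|T|)%N.
  rewrite /vt -size_s; have [lt|ge] := ltnP _ (size s); last by rewrite onth_default.
  by case: (s) lt => // x0 s' lt; rewrite onthE (nth_map x0).
have posK v : vt (ps v) = Some v.
  rewrite /vt pos1 /= -divn_eq.
  by rewrite onthE (nth_map v) ?nth_index // index_mem.
have vtxK p v : vt p = Some v -> ps v = p.
  move=> E; have := vtx_None p; rewrite E /= => /esym lt.
  have ind : (index v s = p.1 * k + p.2)%N.
    have /(onth_nth v) <- := E.
    by rewrite index_uniq // size_s.
  apply/eqP; rewrite -pair_eqE; apply/andP; split; rewrite -(inj_eq val_inj) /=; apply/eqP.
    by rewrite (pos1 v) ind divnMDl // divn_small ?addn0.
  by rewrite ind modnMDl modn_small.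
exists (Layout posK vtxK), (fun b => D (b * k)%N); split.
- by rewrite /D onth_default // size_s ltnW // ltn_ceil.
- rewrite /D; case: (onth s _) => //= v; exact: leq_bigmax.
- move=> b x; rewrite /= -/(D (b * k + x)%N) !D_le //; first exact: leq_addr.
  by rewrite mulSn addnC leq_add2r ltnW.
exists q => x /=.
rewrite -sum1dep_card big_mkcond big_ord_recr /=.
rewrite (eq_bigr (fun=> 1%N)); last first.
  move=> b _; rewrite vtx_None /= ifT //.
  apply: leq_trans (leq_trunc_div #|T| k); rewrite -/q.
  have : (b.+1 * k <= q * k)%N by rewrite leq_mul2r ltn_ord orbT.
  by apply: leq_trans; rewrite mulSn addnC ltn_add2r.
by rewrite sum1_card card_ord; case: ifP => _; rewrite ?addn0 ?addn1 leqnn ?leqnSn.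
Qed.

Lemma sum_layout (T : finType) (k : nat) (L : layout T k) (V : nmodType)
    (F : 'I_(rows L) * 'I_k -> V) :
  (forall p, vtx L p = None -> F p = 0) -> \sum_p F p = \sum_v F (pos L v).
Proof.
move=> F0; rewrite (bigID (fun p => vtx L p != None)) /= [X in _ + X]big1 ?addr0; last first.
  by move=> p; rewrite negbK => /eqP; exact: F0.
rewrite (reindex_omap (pos L) (vtx L)) /=.
  by apply: eq_bigl => v; rewrite !posK eqxx.
by move=> p; case E: (vtx L p) => [v|//] _ /=; rewrite (vtxK L E).
Qed.

(** * The graph on the grid *)

Definition layout_graph (T : finType) (k : nat) (L : layout T k) (e : rel T) :
    rel ('I_(rows L) * 'I_k) := fun p q =>
  if (vtx L p, vtx L q) is (Some u, Some v) then e u v else false.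

Arguments layout_graph {T k} L e p q.

Lemma layout_graph_pos (T : finType) (k : nat) (L : layout T k) (e : rel T) u v :
  layout_graph L e (pos L u) (pos L v) = e u v.
Proof. by rewrite /layout_graph !posK. Qed.

Lemma layout_graph_None (T : finType) (k : nat) (L : layout T k) (e : rel T) p q :
  vtx L p = None \/ vtx L q = None -> layout_graph L e p q = false.
Proof. by rewrite /layout_graph; case: (vtx L p) (vtx L q) => [u|] [v|] []. Qed.

Lemma simple_layout_graph (T : finType) (k : nat) (L : layout T k) (e : rel T) :
  simple_graph e -> simple_graph (layout_graph L e).
Proof.
move=> [esym eirr]; split=> [p q|p]; rewrite /layout_graph.
  by case: (vtx L p) => [u|]; case: (vtx L q) => [v|] //; exact: esym.
by case: (vtx L p).
Qed.

Lemma sum2_layout (R : pzRingType) (T : finType) (k : nat) (L : layout T k) (e : rel T)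
    (F : 'I_(rows L) * 'I_k -> 'I_(rows L) * 'I_k -> R) :
  \sum_p \sum_q (layout_graph L e p q)%:R * F p q =
  \sum_u \sum_v (e u v)%:R * F (pos L u) (pos L v).
Proof.
rewrite sum_layout => [|p p0]; last first.
  by apply: big1 => q _; rewrite layout_graph_None ?mul0r //; left.
apply: eq_bigr => u _; rewrite sum_layout => [|q q0]; last first.
  by rewrite layout_graph_None ?mul0r //; right.
by apply: eq_bigr => v _; rewrite layout_graph_pos.
Qed.

Definition degree (T : finType) (e : rel T) (v : T) : nat := #|[pred u | e v u]|.

Lemma degree_layout (R : pzRingType) (T : finType) (k : nat) (L : layout T k) (e : rel T) p :
  \sum_q (layout_graph L e p q)%:R = (oapp (degree e) 0%N (vtx L p))%:R :> R.
Proof.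
rewrite sum_layout => [|q q0]; last by rewrite layout_graph_None //; right.
case E: (vtx L p) => [v|] /=; last first.
  by rewrite big1 // => u _; rewrite layout_graph_None //; left.
rewrite /degree -sum1_card natr_sum [RHS]big_mkcond; apply: eq_bigr => u _.
by rewrite -(vtxK L E) layout_graph_pos inE; case: (e v u).
Qed.

(** * The partition *)

Definition part (T : finType) (k : nat) (L : layout T k) (w : {ffun 'I_(rows L) -> 'S_k})
    (i : 'I_k) : {set T} :=
  [set v | (pos L v).2 == w (pos L v).1 i].

Lemma part_disjoint (T : finType) (k : nat) (L : layout T k) (w : {ffun 'I_(rows L) -> 'S_k})
    (i j : 'I_k) : i != j -> [disjoint part w i & part w j].
Proof.
move=> nij; rewrite -setI_eq0; apply/eqP/setP => v; rewrite !inE.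
by apply/negP => /andP[/eqP ->]; rewrite (inj_eq perm_inj) (negbTE nij).
Qed.

Lemma part_kpartition (T : finType) (k : nat) (L : layout T k)
    (w : {ffun 'I_(rows L) -> 'S_k}) : is_kpartition (part w).
Proof.
split=> [|i j]; last exact: part_disjoint.
apply/setP => v; rewrite inE; apply/bigcupP.
by exists ((w (pos L v).1)^-1%g (pos L v).2); rewrite // inE permKV.
Qed.

Lemma card_part (T : finType) (k : nat) (L : layout T k)
    (w : {ffun 'I_(rows L) -> 'S_k}) (i : 'I_k) :
  #|part w i| = #|[set b | vtx L (b, w b i) != None]|.
Proof.
rewrite -(card_in_imset (f := fun v => (pos L v).1)); last first.
  move=> u v; rewrite !inE => /eqP u2 /eqP v2 uv.
  apply: Some_inj; rewrite -!(posK L); congr (vtx L _).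
  by apply/eqP; rewrite -pair_eqE /= /pair_eq uv u2 v2 uv !eqxx.
apply: eq_card => b; rewrite inE; apply/imsetP/idP => [[v]|].
  by rewrite inE => /eqP v2 ->; rewrite -v2 -surjective_pairing posK.
case E: (vtx L _) => [v|//] _; exists v; last by rewrite (vtxK L E).
by rewrite inE (vtxK L E).
Qed.

Lemma edges_within_part (R : pzRingType) (T : finType) (e : rel T) (k : nat) (L : layout T k)
    (w : {ffun 'I_(rows L) -> 'S_k}) (i j : 'I_k) : simple_graph e -> i != j ->
  2 * (edges_within e (part w i :|: part w j))%:R =
  \sum_p \sum_q (layout_graph L e p q)%:R * chosen R w i j p * chosen R w i j q :> R.
Proof.
move=> eG nij; under [RHS]eq_bigr => p _ do under eq_bigr => q _ do rewrite -mulrA.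
rewrite (@sum2_layout R T k L e (fun p q => chosen R w i j p * chosen R w i j q)).
have chosenE v : chosen R w i j (pos L v) = (v \in part w i :|: part w j)%:R.
  rewrite /chosen !inE; have := disjointFr (part_disjoint w nij) (x := v).
  by rewrite !inE; case: eqP => // _; [move=> -> // | ]; rewrite ?addr0 ?add0r.
rewrite -sum_adj_within // big_mkcond; apply: eq_bigr => u _.
case uV: (u \in _); last first.
  by rewrite big1 // => v _; rewrite chosenE uV mul0r mulr0.
rewrite big_mkcond; apply: eq_bigr => v _.
by rewrite !chosenE uV mul1r; case: (v \in _); rewrite ?mulr1 ?mulr0.
Qed.

Theorem corollary1p3 (R : rcfType) (k : nat) (hk : (2 <= k)%N)
    (T : finType) (e : rel T) (he : simple_graph e) (n m : nat)
    (hn : #|T| = n) (hm : #|edges e| = m) :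
  exists V : 'I_k -> {set T},
    [/\ is_kpartition V, balanced V &
      (max_pair_edges e V)%:R <=
        4 * m%:R / k%:R ^+ 2
        + 3 * (k%:R - 2) / k%:R ^+ 2 * Num.sqrt (2 * m%:R + 1 / 4)
        + (k%:R - 2) * (2 * k%:R - 5) / 10
        + Cconst R k * n%:R :> R].
Proof.
have [L [H [Hr H0 Hd [q cardq]]]] := @exists_layout T (degree e) k (ltnW hk).
suff [w wB] : exists w : {ffun 'I_(rows L) -> 'S_k}, (max_pair_edges e (part w))%:R <=
        4 * m%:R / k%:R ^+ 2
        + 3 * (k%:R - 2) / k%:R ^+ 2 * Num.sqrt (2 * m%:R + 1 / 4)
        + (k%:R - 2) * (2 * k%:R - 5) / 10
        + Cconst R k * n%:R :> R.
  exists (part w); split=> //; first exact: part_kpartition.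
  move=> i j; rewrite !card_part.
  have := cardq (fun b => w b i); have := cardq (fun b => w b j).
  move: #|_| #|_| => x y /andP[qx xq] /andP[qy yq].
  rewrite ler_norml; apply/andP; split; lia.
have [k3|k2] := ltnP 2 k; last first.
  (* The two parts cover the graph and the bound is [m], so any choice will do. *)
  have kR : k%:R = 2 :> R by congr (_%:R); lia.
  exists [ffun=> 1%g].
  rewrite /Cconst kR subrr !(mul0r, mulr0, addr0).
  rewrite (_ : 4 * m%:R / 2 ^+ 2 = m%:R); last by field.
  apply: max_pair_edges_le => // i j _; rewrite ler_nat -hm -edges_withinT.
  by apply: subset_leq_card; apply/subsetP => A; rewrite !inE => /andP[-> _]; rewrite subsetT.
have hle : (H 0%N)%:R <= n%:R :> R.
  rewrite ler_nat -hn; apply: leq_trans H0 _; apply/bigmax_leqP => v _; exact: max_card.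
have mn : (2 * m <= n * n)%N by rewrite -hm -hn twice_edges_le.
have [||b x|w wP] := @exists_good_perms R (rows L) k m (layout_graph L e)
  (fun b => (H b)%:R) k3 (@simple_layout_graph T k L e he).
- under eq_bigr => p _ do under eq_bigr => p' _ do rewrite -[_%:R]mulr1.
  rewrite sum2_layout -hm -sum_adj //.
  by apply: eq_bigr => u _; apply: eq_bigr => v _; rewrite mulr1.
- by rewrite Hr.
- by rewrite degree_layout !ler_nat.
exists w; apply: (le_trans _ (final_bound k3 hle mn)).
set B := (X in _ <= X).
have le_pair (i j : 'I_k) : (i < j)%N -> (edges_within e (part w i :|: part w j))%:R <= B.
  move=> ij; rewrite -(ler_pM2l (ltr0n R 2)) edges_within_part //.
    exact: wP.
  by rewrite -(inj_eq val_inj) ltn_eqF.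
apply: (max_pair_edges_le _ le_pair).
apply: (le_trans _ (le_pair (Ordinal (ltnW (ltnW k3))) (Ordinal (ltnW k3)) isT)).
exact: ler0n.
Qed.
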